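(* Let $T\ge 1$ be an integer, $\alpha>0$, $\eta=\alpha/\sqrt{T}$, and let $h(x)=\frac{\eta}{2}x^2$ if $|x|\le\eta^{-1}$ and $h(x)=|x|-\frac{1}{2\eta}$ if $|x|>\eta^{-1}$. Then, against every adversary with $|g_t|\le1$ for all $t$, the Stein algorithm with input $h$ and parameters $\rho_t=\sqrt{T-t}$ ($t=0,\dots,T$) guarantees, for all $u\in[-1,1]$, $$\sum_{t=1}^Tg_t(x_t-u)\le\left[\frac{u^2}{2\alpha}+\Big(\alpha+\frac1\alpha\Big)\Phi\Big(\frac1\alpha\Big)+\phi\Big(\frac1\alpha\Big)-\frac{\alpha}{2}-\frac1\alpha\right]\sqrt{T}+O(\log T),$$ where $\Phi,\phi$ are the standard normal CDF and density, and $O(\log T)$ denotes a term bounded by $C(1+\log T)$ for an absolute constant $C$.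
   Context: Online linear optimization (OLO) game with horizon $T$: in each round $t=1,\dots,T$, the algorithm picks $x_t\in[-1,1]$ as a function of $g_1,\dots,g_{t-1}$ (and $T$); the adversary then picks $g_t\in\mathbb{R}$ as a function of $x_1,\dots,x_t$ (and $T$ and the algorithm); the algorithm observes $g_t$. Stein equation solution: for a $1$-Lipschitz $h:\mathbb{R}\to\mathbb{R}$, $\mu\in\mathbb{R}$, $\sigma>0$, let $f_{\mu,\sigma,h}:\mathbb{R}\to\mathbb{R}$ be the unique bounded solution of $\sigma^2f'(x)-(x-\mu)f(x)=h(x)-\mathbb{E}_{Z\sim\mathcal{N}(0,1)}[h(\mu+\sigma Z)]$ for all $x\in\mathbb{R}$. Stein algorithm with input $h$ and parameters $\rho_0\ge\rho_1\ge\dots\ge\rho_T\ge0$ (with $\rho_t>0$ for $t<T$): set $s_0=0$; in round $t$ output $x_t=\mathbb{E}_{Z\sim\mathcal{N}(0,1)}[f_{s_{t-1},\rho_{t-1},h}(s_{t-1}+\rho_tZ)]$, observe $g_t$ and set $s_t=s_{t-1}+g_t$. *)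

(* Defs.v *)
From HB Require Import structures.
From mathcomp Require Import all_boot all_order all_algebra.
From mathcomp Require Import all_classical all_reals all_analysis.

Set Implicit Arguments.
Unset Strict Implicit.
Unset Printing Implicit Defensive.
Import Order.TTheory GRing.Theory Num.Theory.
Import numFieldNormedType.Exports.
Local Open Scope classical_set_scope.
Local Open Scope ring_scope.

Section StandardNormal.
Context {R : realType}.

Definition std_normal_E (F : R -> R) : R := fine 'E_(normal_prob (0 : R) 1)[F].

Definition std_normal_cdf (x : R) : R := fine (normal_prob (0 : R) 1 `]-oo, x]).

Definition std_normal_pdf (x : R) : R := normal_pdf 0 1 x.

End StandardNormal.

Section OnlineLinearOptimization.
Context {R : realType}.

(* An algorithm maps the past [:: g_1; ...; g_(t-1)] to x_t, and an adversary  *)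
(* maps [:: x_1; ...; x_t] to g_t.  Both may depend on anything quantified     *)
(* before them: the horizon, and the algorithm in the case of the adversary.   *)
Definition olo_algorithm := seq R -> R.
Definition olo_adversary := seq R -> R.

Fixpoint olo_play (A : olo_algorithm) (B : olo_adversary) (n : nat) :
    seq R * seq R :=
  if n is m.+1 then
    let: (xs, gs) := olo_play A B m in
    let xs' := rcons xs (A gs) in
    (xs', rcons gs (B xs'))
  else ([::], [::]).

(* Entry number t of the lists (counting from 0) belongs to round t + 1. *)
Definition olo_x A B (T t : nat) : R := (olo_play A B T).1`_t.
Definition olo_g A B (T t : nat) : R := (olo_play A B T).2`_t.

Definition olo_regret A B (T : nat) (u : R) : R :=
  \sum_(t < T) olo_g A B T t * (olo_x A B T t - u).

End OnlineLinearOptimization.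

Section Stein.
Context {R : realType}.

Definition bounded_stein_solution (h : R -> R) (mu sigma : R) : set (R -> R) :=
  [set f : R -> R | bounded_fun f /\
    forall x : R, derivable f x 1 /\
      sigma ^+ 2 * derive1 f x - (x - mu) * f x
        = h x - std_normal_E (fun z => h (mu + sigma * z))].

(* The default value 0 is returned only if there is no bounded solution. *)
Definition stein_solution (h : R -> R) (mu sigma : R) : R -> R :=
  xget (fun=> 0) (bounded_stein_solution h mu sigma).

Definition stein_algorithm (h : R -> R) (rho : nat -> R) : olo_algorithm :=
  fun gs =>
    let t := (size gs).+1 in
    let s := \sum_(g <- gs) g in
    std_normal_E (fun z => stein_solution h s (rho t.-1) (s + rho t * z)).

End Stein.

Definition huber (R : realType) (eta x : R) : R :=
  if `|x| <= eta^-1 then eta / 2 * x ^+ 2 else `|x| - (2 * eta)^-1.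

(* Main.v *)
Require Import Defs.
From mathcomp Require Import all_boot all_order all_algebra.
From mathcomp Require Import all_classical all_reals all_analysis.
From mathcomp Require Import measurable_realfun.
From mathcomp Require Import ring lra.
Import Order.TTheory GRing.Theory Num.Theory.
Import numFieldNormedType.Exports.
Set Implicit Arguments.
Unset Strict Implicit.
Unset Printing Implicit Defensive.
Local Open Scope classical_set_scope.
Local Open Scope ring_scope.

(* Write V_t(s) = E h(s + rho_t Z) and let f solve the Stein equation of round t.
   Evaluating the equation at s + g + rho_t Z and integrating by parts gives
     V_t(s + g) - V_(t-1)(s) = E [f'(s + g + rho_t Z)] - g E [f(s + g + rho_t Z)],
   because rho_(t-1)^2 - rho_t^2 = 1.  As x_t = E [f(s + rho_t Z)], the loss g x_t is
   the decrease of V plus the expectation of f'(w + g) - g (f(w + g) - f(w)) at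
   w = s + rho_t Z.  Since h is convex, f' <= 0, and f' is Lipschitz with constant
   4 / rho_(t-1)^2, so |g| <= 1 bounds this error by 4 / (T - t + 1); summing over t
   gives 4 (1 + log T).  What remains is V_0(0) - h(s_T) - u s_T, where
   - h(s) - u s <= u^2 / (2 eta) by Fenchel-Young and V_0(0) is computed explicitly.
   All bounds on f come from one observation: a solution of G' >= x G which is
   positive somewhere grows like exp(x^2 / 2) to the right of that point. *)

(** * Integrals against the normal density *)

Section normal_integral.
Context {R : realType}.
Notation mu := (@lebesgue_measure R).
Notation N01 := (normal_prob (0 : R) 1).

(** The density of [normal_prob] and its Radon-Nikodym derivative have the same integral over every
    measurable set, so they agree almost everywhere and the change of variables can use either. *)
Lemma ge0_integral_normal_prob (m s : R) (f : R -> \bar R) :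
  (forall x, (0 <= f x)%E) -> measurable_fun [set: R] f ->
  (\int[normal_prob m s]_x f x = \int[mu]_x (f x * (normal_pdf m s x)%:E))%E.
Proof.
move=> f0 mf; have dom := normal_prob_dominates m s.
rewrite -(Radon_Nikodym_SigmaFinite.change_of_variables dom)//.
have mg := measurable_int _ (Radon_Nikodym_SigmaFinite.f_integrable dom).
have mpdf : measurable_fun setT (EFin \o normal_pdf m s).
  by apply/measurable_EFinP; exact: measurable_normal_pdf.
apply: ae_eq_integral => //.
- exact: emeasurable_funM.
- exact: emeasurable_funM.
- apply: ae_eqe_mul2l.
  apply: integral_ae_eq => //.
  + exact: (Radon_Nikodym_SigmaFinite.f_integrable dom).
  + move=> E _ mE.
    by rewrite -(Radon_Nikodym_SigmaFinite.f_integral dom).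
Qed.

Lemma integrable_normal_prob (m s : R) (f : R -> R) :
  measurable_fun [set: R] f ->
  mu.-integrable [set: R] (fun x => (f x * normal_pdf m s x)%:E) ->
  (normal_prob m s).-integrable [set: R] (EFin \o f).
Proof.
move=> mf /integrableP[mfp fp]; apply/integrableP; split.
  exact/measurable_EFinP.
rewrite ge0_integral_normal_prob//; last first.
  by do 2 apply: measurableT_comp => //.
move: fp; congr (_ < _)%E; apply: eq_integral => x _.
by rewrite !abse_EFin -EFinM normrM (ger0_norm (normal_pdf_ge0 _ _ _)).
Qed.

Lemma integral_normal_prob (m s : R) (f : R -> R) :
  measurable_fun [set: R] f ->
  mu.-integrable [set: R] (fun x => (f x * normal_pdf m s x)%:E) ->
  (\int[normal_prob m s]_x (f x)%:E
   = \int[mu]_x (f x * normal_pdf m s x)%:E)%E.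
Proof.
move=> mf ifp.
have if1 := integrable_normal_prob mf ifp.
rewrite integralE ge0_integral_normal_prob//; last first.
  by apply: measurable_funepos; exact/measurable_EFinP.
rewrite ge0_integral_normal_prob//; last first.
  by apply: measurable_funeneg; exact/measurable_EFinP.
rewrite [RHS]integralE; congr (_ - _)%E; apply: eq_integral => x _.
  rewrite !funeposE -!EFin_max -EFinM.
  by rewrite maxr_pMl ?normal_pdf_ge0// mul0r.
rewrite !funenegE -!EFinN -!EFin_max -EFinM.
by rewrite maxr_pMl ?normal_pdf_ge0// mul0r mulNr.
Qed.

(** [|k|] dominates every restriction, and the last hypothesis makes the restrictions eventually
    constant at each point. Used with half-lines, this gives the limits of a primitive at both
    infinities. *)
Lemma dominated_convergence_restrict (k : R -> R) (A : (set R)^nat) (B : set R) :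
  mu.-integrable [set: R] (EFin \o k) ->
  (forall n, measurable (A n)) -> measurable B ->
  (forall x, \forall n \near \oo, (x \in A n) = (x \in B)) ->
  \int[mu]_(t in A n) k t @[n --> \oo] --> \int[mu]_(t in B) k t.
Proof.
move=> ik mA mB AB; have mk := measurable_int _ ik.
have mk' : measurable_fun [set: R] k by exact/measurable_EFinP.
have mres C : measurable C -> measurable_fun [set: R] (k \_ C).
  move=> mC; apply/(measurable_restrictT _ _).1 => //.
  exact: measurable_funTS.
have [|||||ikB _ +] := @dominated_convergence _ _ _ mu setT measurableT
   (fun n x => ((k \_ (A n)) x)%:E) (fun x => ((k \_ B) x)%:E) (fun x => `|k x|%:E).
- by move=> n; apply/measurable_EFinP; exact: mres.
- by apply/measurable_EFinP; exact: mres.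
- apply: aeW => x _; apply: cvg_near_cst.
  have := AB x; apply: filterS => n ABn.
  by rewrite !patchE ABn.
- exact: integrable_abse ik.
- apply: aeW => x n _; rewrite abse_EFin lee_fin patchE.
  by case: ifP => // _; rewrite normr0.
have fB : (\int[mu]_x ((k \_ B) x)%:E)%E \is a fin_num by exact: integrable_fin_num.
rewrite [in X in X -> _]/= -(fineK fB) => /fine_cvgP[_].
rewrite /comp /=.
under [in X in X -> _]eq_fun do rewrite -[fine _]/(Rintegral _ _ _) -Rintegral_mkcond.
by rewrite -[fine _]/(Rintegral _ _ _) -Rintegral_mkcond.
Qed.

Lemma Rintegral_itvNy_cvg (k : R -> R) :
  mu.-integrable [set: R] (EFin \o k) ->
  \int[mu]_(t in `]-oo, x]) k t @[x --> -oo] --> 0 /\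
  \int[mu]_(t in `]-oo, x]) k t @[x --> +oo] --> \int[mu]_t k t.
Proof.
move=> ik; split.
- rewrite -(Rintegral_set0 mu k); apply/cvg_ninftyP => u uNy.
  apply: (dominated_convergence_restrict ik) => // x.
  move/cvgrNyPlt : uNy => /(_ x); apply: filterS => n unx.
  by rewrite in_set0; apply/negbTE/negP; rewrite inE /= in_itv /= leNgt unx.
- apply/cvg_pinftyP => u uy.
  apply: (dominated_convergence_restrict ik) => // x.
  move/cvgryPge : uy => /(_ x); apply: filterS => n unx.
  by rewrite in_setT; apply/mem_set; rewrite /= in_itv.
Qed.

Lemma is_derive_Rintegral_itvNy (k : R -> R) x :
  mu.-integrable [set: R] (EFin \o k) -> continuous k ->
  is_derive x (1 : R) (fun y => \int[mu]_(t in `]-oo, y]) k t) (k x).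
Proof.
move=> ik ck.
have [||d e] := @continuous_FTC1 R k -oo%O x (x + 1) _ _ (ltNyr _) (ck x).
- by rewrite ltrDl.
- exact: integrableS ik.
by apply: DeriveDef; [exact: d|rewrite -derive1E; exact: e].
Qed.

(** [G] and the primitive of [k] over half-lines have the same derivative, so they differ by a
    constant, which is read off at both infinities. The sign of [k] is arbitrary. *)
Lemma Rintegral_FTC2 (G k : R -> R) (a b : R) :
  (forall x, is_derive x (1 : R) G (k x)) -> continuous k ->
  mu.-integrable [set: R] (EFin \o k) ->
  G x @[x --> -oo] --> a -> G x @[x --> +oo] --> b ->
  \int[mu]_t k t = b - a.
Proof.
move=> dG ck ik Ga Gb.
have [K0 K1] := Rintegral_itvNy_cvg ik.
set K := fun y => \int[mu]_(t in `]-oo, y]) k t.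
have dK x : is_derive x (1:R) K (k x) by exact: is_derive_Rintegral_itvNy.
have c x : G x - K x = G 0 - K 0.
  have d0 y : is_derive y (1 : R) (G \- K) 0.
    by have -> : (0 : R) = k y - k y by [rewrite subrr]; exact: is_deriveB.
  exact: (@is_derive_0_is_cst R (G \- K) x 0 d0).
have aE : a = G 0 - K 0.
  have : (G \- K) x @[x --> -oo] --> a - 0 by apply: cvgB.
  rewrite subr0 (_ : G \- K = cst (G 0 - K 0)); last by apply/funext => x; exact: c.
  by move=> /(cvg_unique _); apply => //; exact: cvg_cst.
have bE : b - \int[mu]_t k t = G 0 - K 0.
  have : (G \- K) x @[x --> +oo] --> b - \int[mu]_t k t by apply: cvgB.
  rewrite (_ : G \- K = cst (G 0 - K 0)); last by apply/funext => x; exact: c.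
  by move=> /(cvg_unique _); apply => //; exact: cvg_cst.
by rewrite aE -bE opprB addrCA subrr addr0.
Qed.
End normal_integral.

(** * Gaussian expectations of functions of at most quadratic growth *)

Section gaussian_growth.
Context {R : realType}.
Notation mu := (@lebesgue_measure R).
Implicit Types F G : R -> R.

Lemma std_normal_pdfE (x : R) :
  std_normal_pdf x = normal_peak 1 * expR (- (x ^+ 2 / 2)).
Proof.
rewrite /std_normal_pdf normal_pdfE ?oner_neq0// /normal_fun subr0 expr1n.
by rewrite mulNr.
Qed.

Lemma std_normal_pdf_gt0 (x : R) : 0 < std_normal_pdf x.
Proof. by rewrite std_normal_pdfE mulr_gt0 ?expR_gt0 ?normal_peak_gt0 ?oner_neq0. Qed.

Lemma is_derive_std_normal_pdf (x : R) :
  is_derive x (1 : R) std_normal_pdf (- x * std_normal_pdf x).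
Proof.
have -> : @std_normal_pdf R =
    (fun y => normal_peak 1 * expR (- (y ^+ 2 / 2))).
  by apply/funext => y; exact: std_normal_pdfE.
have d : is_derive x (1 : R) (fun y : R => - (y ^+ 2 / 2)) (- x).
  by apply: is_derive_eq; rewrite /GRing.scale /=; field.
apply: is_derive_eq; rewrite /GRing.scale /=; ring.
Qed.

Lemma continuous_std_normal_pdf : continuous (@std_normal_pdf R).
Proof. by apply: continuous_normal_pdf; rewrite oner_neq0. Qed.

(* The variance is increased from 1 to 4 to absorb the polynomial factor. *)
Lemma std_normal_pdf_quadratic_le : exists2 C : R, 0 <= C &
  forall x, (1 + x ^+ 2) * std_normal_pdf x <= C * normal_pdf 0 2 x.
Proof.
have n2 : (2 : R) != 0 by rewrite pnatr_eq0.
have p1 : 0 < normal_peak (1 : R) by rewrite normal_peak_gt0 ?oner_neq0.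
have p2 : 0 < normal_peak (2 : R) by rewrite normal_peak_gt0.
exists (3 * normal_peak 1 / normal_peak 2) => [|x].
  by rewrite divr_ge0 ?mulr_ge0 ?normal_peak_ge0.
rewrite std_normal_pdfE normal_pdfE// /normal_fun subr0.
rewrite [leRHS]mulrA divfK ?gt_eqF//.
(* Part of the exponent is kept for the density of variance 4; the rest, [3 / 8 * x ^+ 2], pays for
   the polynomial because [1 + x ^+ 2 <= 3 * (1 + 3 / 8 * x ^+ 2)]. *)
have -> : - (x ^+ 2 / 2) = - x ^+ 2 / (2 ^+ 2 *+ 2) - 3 / 8 * x ^+ 2 :> R by field.
rewrite expRD expRN.
set a := expR (- x ^+ 2 / _); set b := expR (_ * _).
have a0 : 0 < a by exact: expR_gt0.
have b0 : 0 < b by exact: expR_gt0.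
have b1 : 1 + 3 / 8 * x ^+ 2 <= b by exact: expR_ge1Dx.
rewrite (_ : (1 + x ^+ 2) * _ = (normal_peak 1 * a) * ((1 + x ^+ 2) / b)); last by ring.
rewrite (_ : 3 * _ * a = (normal_peak 1 * a) * 3); last by ring.
rewrite ler_pM2l ?mulr_gt0// ler_pdivrMr//.
by have := sqr_ge0 x; lra.
Qed.

(** Quadratic growth is small enough for integrability against the normal density and large enough
    to contain [z * F z] for every [F] of linear growth, as integration by parts requires. *)
Definition tame F := continuous F /\ exists C, forall x, `|F x| <= C * (1 + x ^+ 2).

Lemma tame_integrable F : tame F ->
  mu.-integrable [set: R] (fun x => (F x * std_normal_pdf x)%:E).
Proof.
move=> [cF [C FC]]; have [D D0 hD] := std_normal_pdf_quadratic_le.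
apply: (@le_integrable _ _ _ mu _ measurableT _
  (fun x => (C * D * normal_pdf 0 2 x)%:E)) => //.
- apply/measurable_EFinP; apply: measurable_funM.
    exact: continuous_measurable_fun.
  exact: measurable_normal_pdf.
- move=> x _; rewrite !abse_EFin lee_fin normrM (gtr0_norm (std_normal_pdf_gt0 x)).
  apply: (@le_trans _ _ (C * (1 + x ^+ 2) * std_normal_pdf x)).
    by rewrite ler_wpM2r ?FC// ltW// std_normal_pdf_gt0.
  have C0 : 0 <= C by have := FC 0; rewrite expr0n addr0 mulr1; exact: le_trans.
  by rewrite (le_trans _ (ler_norm _))// -!mulrA ler_wpM2l.
- under eq_fun do rewrite EFinM.
  by apply: integrableZl => //; exact: integrable_normal_pdf.
Qed.

Lemma tame_measurable F : tame F -> measurable_fun [set: R] F.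
Proof. by move=> [cF _]; exact: continuous_measurable_fun. Qed.

Lemma tame_integrable_normal F : tame F ->
  (normal_prob (0 : R) 1).-integrable [set: R] (EFin \o F).
Proof.
by move=> tF; apply: integrable_normal_prob; [exact: tame_measurable|exact: tame_integrable].
Qed.

Lemma std_normal_EE F : std_normal_E F = \int[normal_prob (0 : R) 1]_x F x.
Proof. by rewrite /std_normal_E unlock. Qed.

Lemma std_normal_E_pdf F : tame F ->
  std_normal_E F = \int[mu]_x (F x * std_normal_pdf x).
Proof.
move=> tF; rewrite std_normal_EE /Rintegral integral_normal_prob//.
  exact: tame_measurable.
exact: tame_integrable.
Qed.

Lemma eq_std_normal_E F G : F =1 G -> std_normal_E F = std_normal_E G.
Proof. by move=> FG; congr std_normal_E; exact/funext. Qed.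

Lemma std_normal_ED F G : tame F -> tame G ->
  std_normal_E (fun z => F z + G z) = std_normal_E F + std_normal_E G.
Proof. by move=> tF tG; rewrite !std_normal_EE RintegralD//; exact: tame_integrable_normal. Qed.

Lemma std_normal_EB F G : tame F -> tame G ->
  std_normal_E (fun z => F z - G z) = std_normal_E F - std_normal_E G.
Proof. by move=> tF tG; rewrite !std_normal_EE RintegralB//; exact: tame_integrable_normal. Qed.

Lemma std_normal_EZ c F : tame F ->
  std_normal_E (fun z => c * F z) = c * std_normal_E F.
Proof. by move=> tF; rewrite !std_normal_EE RintegralZl//; exact: tame_integrable_normal. Qed.

Lemma std_normal_E_le F G : tame F -> tame G -> (forall z, F z <= G z) ->
  std_normal_E F <= std_normal_E G.
Proof.
by move=> tF tG FG; rewrite !std_normal_EE le_Rintegral//; exact: tame_integrable_normal.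
Qed.

Lemma std_normal_E_cst c : std_normal_E (fun=> c : R) = c.
Proof. by rewrite /std_normal_E expectation_cst. Qed.

Lemma tame_cst c : tame (fun=> c : R).
Proof.
split=> [x|]; first exact: cvg_cst.
exists `|c| => x; rewrite ler_peMr// lerDl sqr_ge0//.
Qed.

Lemma tame_id : tame (fun z : R => z).
Proof.
split=> [x|]; first exact: cvg_id.
exists 1 => x; rewrite mul1r; have := sqr_ge0 (`|x| - 1).
rewrite -(real_normK (num_real x)); nra.
Qed.

Lemma tameD F G : tame F -> tame G -> tame (fun z => F z + G z).
Proof.
move=> [cF [C FC]] [cG [D GD]]; split=> [x|]; first by apply: cvgD; [exact: cF|exact: cG].
exists (C + D) => x; rewrite mulrDl (le_trans (ler_normD _ _))// lerD//.
Qed.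

Lemma tameZ c F : tame F -> tame (fun z => c * F z).
Proof.
move=> [cF [C FC]]; split=> [x|]; first by apply: cvgM; [exact: cvg_cst|exact: cF].
by exists (`|c| * C) => x; rewrite normrM -mulrA ler_wpM2l.
Qed.

Lemma tameB F G : tame F -> tame G -> tame (fun z => F z - G z).
Proof.
move=> tF /(tameZ (-1)) /(tameD tF).
by rewrite (_ : (fun z => F z + -1 * G z) = (fun z => F z - G z))//; apply/funext => z; rewrite mulN1r.
Qed.

Lemma tame_sqr : tame (fun z : R => z ^+ 2).
Proof.
split=> [x|]; first exact: exprn_continuous.
by exists 1 => x; rewrite mul1r ger0_norm ?sqr_ge0// lerDr.
Qed.

Lemma tame_comp_affine F (a b : R) : tame F -> tame (fun z => F (a + b * z)).
Proof.
move=> [cF [C FC]]; split=> [x|].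
  apply: continuous_comp; last exact: cF.
  by apply: cvgD; [exact: cvg_cst|apply: cvgM; [exact: cvg_cst|exact: cvg_id]].
have C0 : 0 <= C by have := FC 0; rewrite expr0n addr0 mulr1; exact: le_trans.
exists (C * (2 + 2 * a ^+ 2 + 2 * b ^+ 2)) => x; rewrite (le_trans (FC _))//.
rewrite -mulrA ler_wpM2l//.
have h := sqr_ge0 (a - b * x); have h1 := sqr_ge0 a; have h2 := sqr_ge0 b.
have h3 := sqr_ge0 x; have h4 := mulr_ge0 h1 h3; nra.
Qed.

Lemma linear_growth_tame F (A B : R) : continuous F ->
  (forall x, `|F x| <= A + B * `|x|) -> tame F.
Proof.
move=> cF FAB; split=> //; exists (`|A| + `|B|) => x.
rewrite (le_trans (FAB x))// -(real_normK (num_real x)).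
set n := `|x|; have n0 : 0 <= n by exact: normr_ge0.
have n1 : 0 <= 1 + n ^+ 2 - n by have := sqr_ge0 (n - 1); nra.
have h1 := mulr_ge0 (normr_ge0 B) n1.
have h2 := mulr_ge0 (normr_ge0 A) (sqr_ge0 n).
have h3 : B * n <= `|B| * n by rewrite ler_wpM2r ?ler_norm.
have := ler_norm A; lra.
Qed.

End gaussian_growth.

(** * Gaussian integration by parts and the Stein equation *)

Section monotone.
Context {R : realType}.
Implicit Types f df : R -> R.

Lemma is_derive_continuous f (x d : R) :
  is_derive x (1 : R) f d -> {for x, continuous f}.
Proof.
by move=> [df _]; apply: differentiable_continuous; exact/derivable1_diffP.
Qed.

Lemma is_derive_MVT f df (a b : R) : a <= b ->
  (forall x, a <= x <= b -> is_derive x (1 : R) f (df x)) ->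
  exists2 c, a <= c <= b & f b - f a = df c * (b - a).
Proof.
move=> ab dfab; have [x|x|c cab fba] := @MVT_segment R f df a b ab.
- by rewrite in_itv /= => /andP[ax xb]; apply: dfab; rewrite !ltW.
- apply: derivable_within_continuous => y; rewrite in_itv /= => yab.
  by have [] := dfab y yab.
- by exists c.
Qed.

Lemma is_derive_ge0_le f df (a b : R) : a <= b ->
  (forall x, a <= x <= b -> is_derive x (1 : R) f (df x)) ->
  (forall x, a <= x <= b -> 0 <= df x) -> f a <= f b.
Proof.
move=> ab dfab df0; have [c cab fba] := is_derive_MVT ab dfab.
by rewrite -subr_ge0 fba mulr_ge0 ?subr_ge0 ?df0.
Qed.

Lemma cvgNy0_ge0 f df (a : R) : (forall x, is_derive x (1 : R) f (df x)) ->
  (forall x, x <= a -> 0 <= df x) -> f x @[x --> -oo] --> 0 ->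
  forall x, x <= a -> 0 <= f x.
Proof.
move=> dF df0 f0 x xa; apply: (cvgr_to_le f0).
have := @nbhs_ninfty_le R x (num_real x); apply: filterS => y yx.
apply: (@is_derive_ge0_le f df) => // z /andP[_ zx].
by apply: df0; exact: le_trans xa.
Qed.

Lemma cvgy0_ge0 f df (a : R) : (forall x, is_derive x (1 : R) f (df x)) ->
  (forall x, a <= x -> df x <= 0) -> f x @[x --> +oo] --> 0 ->
  forall x, a <= x -> 0 <= f x.
Proof.
move=> dF df0 f0 x xa; apply: (cvgr_to_le f0).
have := @nbhs_pinfty_ge R x (num_real x); apply: filterS => y yx.
rewrite -lerN2; apply: (@is_derive_ge0_le (fun t => - f t) (fun t => - df t)) => // z /andP[xz _].
by rewrite oppr_ge0; apply: df0; exact: le_trans xz.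
Qed.

Lemma decay_cvg0 f (D : R) : (forall x, `|f x| * `|x| <= D) ->
  f x @[x --> -oo] --> 0 /\ f x @[x --> +oo] --> 0.
Proof.
move=> fD; have key (e x : R) : 0 < e -> D / e <= `|x| -> 0 < `|x| -> `|f x| <= e.
  move=> e0; rewrite ler_pdivrMr// => Dx x0.
  by rewrite -(ler_pM2r x0) (le_trans (fD x))// mulrC.
split; apply/cvgr0Pnorm_le => e e0.
- near=> x; have x0 : x < 0 by near: x; exact: nbhs_ninfty_lt.
  apply: key => //; rewrite ltr0_norm ?oppr_gt0//.
  by rewrite lerNr; near: x; apply: nbhs_ninfty_le; exact: num_real.
- near=> x; have x0 : 0 < x by near: x; exact: nbhs_pinfty_gt.
  by apply: key => //; rewrite gtr0_norm.
Unshelve. all: by end_near. Qed.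

Lemma bounded_funPn f : bounded_fun f <-> exists M, forall x, `|f x| <= M.
Proof.
split=> [[M [Mr fM]]|[M fM]].
  by exists (M + 1) => x; apply: (fM (M + 1)) => //; rewrite ltrDl.
by exists M; split; [exact: num_real|move=> y My x _ /=; rewrite (le_trans (fM x))// ltW].
Qed.

Lemma bounded_segment f (a b : R) : a <= b -> continuous f ->
  exists M, forall x, a <= x <= b -> `|f x| <= M.
Proof.
move=> ab cf; have [|c _ fc] := @EVT_max R (fun x => `|f x|) a b ab.
  apply: continuous_subspaceT => x; apply: continuous_comp; first exact: cf.
  exact: norm_continuous.
by exists `|f c| => x xab; apply: fc; rewrite in_itv.
Qed.

End monotone.

Section gaussian_decay.
Context {R : realType}.
Implicit Types F H : R -> R.

(** From [1 + x ^+ 2 / 2 <= expR (x ^+ 2 / 2)], the product [(1 + x ^+ 2) * std_normal_pdf x] is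
    bounded. One factor [|x|] absorbs the growth of [F], the other forces decay. *)
Lemma linear_growth_pdf_cvg0 F (A B : R) : (forall x, `|F x| <= A + B * `|x|) ->
  (F x * std_normal_pdf x @[x --> -oo] --> 0) /\
  (F x * std_normal_pdf x @[x --> +oo] --> 0).
Proof.
move=> FAB; apply: (@decay_cvg0 _ _ ((`|A| + `|B|) * (2 * normal_peak 1))) => x.
rewrite normrM (gtr0_norm (std_normal_pdf_gt0 x)).
have p0 : 0 < normal_peak (1 : R) by rewrite normal_peak_gt0 ?oner_neq0.
have hphi : (1 + x ^+ 2) * std_normal_pdf x <= 2 * normal_peak 1.
  rewrite std_normal_pdfE expRN mulrCA mulrC ler_pM2r// ler_pdivrMr ?expR_gt0//.
  have := expR_ge1Dx (x ^+ 2 / 2); have := sqr_ge0 x; lra.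
have phi0 := std_normal_pdf_gt0 x.
apply: (@le_trans _ _ ((`|A| + `|B|) * ((1 + x ^+ 2) * std_normal_pdf x))); last first.
  by rewrite ler_wpM2l ?addr_ge0.
rewrite mulrAC mulrA ler_wpM2r ?(ltW phi0)//.
have n0 := normr_ge0 x; rewrite -(real_normK (num_real x)).
move: (FAB x) n0; set n := `|x| => Fx n0.
have n1 : 0 <= 1 + n ^+ 2 - n by have := sqr_ge0 (n - 1); nra.
have h1 := mulr_ge0 (normr_ge0 A) n1.
have h2 := mulr_ge0 (normr_ge0 B) (sqr_ge0 n).
apply: (@le_trans _ _ ((`|A| + `|B| * n) * n)).
  rewrite ler_wpM2r// (le_trans Fx)// lerD ?ler_norm//.
  by rewrite ler_wpM2r ?ler_norm.
have := normr_ge0 B; nra.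
Qed.

(** The derivative of [F * std_normal_pdf] is [(dF - z * F) * std_normal_pdf], and the product
    vanishes at both infinities. *)
Lemma std_normal_E_ibp F dF (A B : R) :
  (forall x, is_derive x (1 : R) F (dF x)) -> tame dF ->
  (forall x, `|F x| <= A + B * `|x|) ->
  std_normal_E (fun z => z * F z) = std_normal_E dF.
Proof.
move=> hF tdF FAB.
have cF : continuous F by move=> x; exact: is_derive_continuous (hF x).
have tzF : tame (fun z => z * F z).
  split=> [x|]; first by apply: cvgM; [exact: cvg_id|exact: cF].
  exists (`|A| + `|B|) => x; rewrite normrM.
  have n0 := normr_ge0 x; rewrite -(real_normK (num_real x)).
  move: (FAB x) n0; set n := `|x| => Fx n0.
  have n1 : 0 <= 1 + n ^+ 2 - n by have := sqr_ge0 (n - 1); nra.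
  have h1 := mulr_ge0 (normr_ge0 A) n1.
  have h2 := mulr_ge0 (normr_ge0 B) (sqr_ge0 n).
  apply: (@le_trans _ _ (n * (`|A| + `|B| * n))).
    rewrite ler_wpM2l// (le_trans Fx)// lerD ?ler_norm//.
    by rewrite ler_wpM2r ?ler_norm.
  have := normr_ge0 B; nra.
have tB := tameB tdF tzF.
have [c0 c1] := linear_growth_pdf_cvg0 FAB.
apply/esym/eqP; rewrite -subr_eq0 -std_normal_EB// std_normal_E_pdf//; apply/eqP.
rewrite -[RHS](subrr 0).
apply: (Rintegral_FTC2 (G := fun x => F x * std_normal_pdf x)) => //.
- move=> x; have h1 := hF x; have h2 := is_derive_std_normal_pdf x.
  by apply: is_derive_eq; rewrite /GRing.scale /=; ring.
- move=> x; apply: cvgM; first exact: tB.1.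
  exact: continuous_std_normal_pdf.
- exact: tame_integrable.
Qed.

(* [f phi] is the primitive of [(H - E H(Z)) phi] which vanishes at both ends, so
   that on the tails [f] is controlled by comparing with multiples of [phi]. *)
Lemma std_stein_existence H (A B : R) : continuous H ->
  (forall x, `|H x| <= A + B * `|x|) ->
  exists f, bounded_fun f /\
    forall x, is_derive x (1 : R) f (x * f x + H x - std_normal_E H).
Proof.
move=> cH HAB; set c := std_normal_E H.
have tH := linear_growth_tame cH HAB.
have tHc : tame (fun x => H x - c) by apply: tameB => //; exact: tame_cst.
pose k x := (H x - c) * std_normal_pdf x.
have ik : lebesgue_measure.-integrable [set: R] (EFin \o k) by exact: tame_integrable.
have ck : continuous k.
  by move=> x; apply: cvgM; [exact: tHc.1|exact: continuous_std_normal_pdf].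
pose K x := \int[lebesgue_measure]_(t in `]-oo, x]) k t.
have [K0 K1] := Rintegral_itvNy_cvg ik.
(* Centring [H] at its expectation is what makes [K] vanish at [+oo] as well as at [-oo]. *)
have intk : \int[lebesgue_measure]_t k t = 0.
  rewrite -std_normal_E_pdf// std_normal_EB//; last exact: tame_cst.
  by rewrite std_normal_E_cst subrr.
rewrite intk -/K in K1; rewrite -/K in K0.
have dK x : is_derive x (1 : R) K (k x) by exact: is_derive_Rintegral_itvNy.
have dphi := @is_derive_std_normal_pdf R.
have phi0 := @std_normal_pdf_gt0 R.
have df x : is_derive x (1 : R) (fun y => K y / std_normal_pdf y)
    (x * (K x / std_normal_pdf x) + H x - c).
  have h1 := dK x; have h2 := dphi x; have n0 : std_normal_pdf x != 0 by rewrite gt_eqF.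
  have h3 := is_deriveV n0.
  apply: is_derive_eq; rewrite /GRing.scale /= /k; field.
  exact: n0.
exists (fun x => K x / std_normal_pdf x); split => //.
apply/bounded_funPn.
have [|M KM] := @bounded_segment R _ (-1) 1 _ (fun x => is_derive_continuous (df x)); first lra.
pose D := `|c| + `|A| + `|B|.
have HD x : 1 <= `|x| -> `|H x - c| <= D * `|x|.
  move=> x1; rewrite (le_trans (ler_normB _ _))//.
  have := HAB x; have := ler_norm A; have := ler_norm B.
  have := normr_ge0 c; have := normr_ge0 A; have := normr_ge0 B.
  rewrite /D; move: x1; set n := `|x|; nra.
have [p0 p1] : (D * std_normal_pdf x @[x --> -oo] --> 0) /\
  (D * std_normal_pdf x @[x --> +oo] --> 0).
  by apply: (@linear_growth_pdf_cvg0 (fun=> D) `|D| 0) => x; rewrite mul0r addr0.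
have dG (s : R) x : is_derive x (1 : R) (fun y => D * std_normal_pdf y + s * K y)
    ((s * (H x - c) - D * x) * std_normal_pdf x).
  have h1 := dK x; have h2 := dphi x.
  by apply: is_derive_eq; rewrite /GRing.scale /= /k; ring.
(* For [|x| >= 1] the choice of [D] gives the derivative in [dG] the sign of [- x], and the function
   tends to 0 at both ends. Taking [s = 1] and [s = -1] yields [|K| <= D * std_normal_pdf] there,
   hence the bound [D] on the solution. *)
have tail (s x : R) : `|s| = 1 -> 1 <= `|x| -> 0 <= D * std_normal_pdf x + s * K x.
  move=> s1; have sH y : 1 <= `|y| -> `|s * (H y - c)| <= D * `|y|.
    by move=> y1; rewrite normrM s1 mul1r HD.
  case: (leP 0 x) => x0.
    rewrite (ger0_norm x0); apply: (cvgy0_ge0 (dG s)).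
      move=> y y1; rewrite pmulr_lle0//; have y0 : 0 <= y by lra.
      have := sH y; rewrite ger0_norm// => /(_ y1); rewrite ler_norml; lra.
    rewrite -[X in _ --> X](_ : 0 + s * 0 = 0); last by rewrite mulr0 addr0.
    by apply: cvgD => //; apply: cvgM => //; exact: cvg_cst.
  rewrite (ltr0_norm x0) lerNr; apply: (cvgNy0_ge0 (dG s)).
    move=> y y1; rewrite pmulr_lge0//; have y0 : y < 0 by lra.
    have := sH y; rewrite ltr0_norm// lerNr => /(_ y1); rewrite ler_norml; lra.
  rewrite -[X in _ --> X](_ : 0 + s * 0 = 0); last by rewrite mulr0 addr0.
  by apply: cvgD => //; apply: cvgM => //; exact: cvg_cst.
exists (Num.max M D) => x; rewrite le_max.
case: (leP 1 `|x|) => [x1|/ltW]; last first.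
  by rewrite ler_norml => /KM ->.
apply/orP; right; rewrite normf_div (gtr0_norm (phi0 x)) ler_pdivrMr//.
have := tail 1 x (normr1 _) x1; have := tail (-1) x _ x1.
rewrite normrN normr1 => /(_ erefl); rewrite ler_norml; lra.
Qed.

End gaussian_decay.

(** * Bounds on the solution of the Stein equation *)

Section stein_ode.
Context {R : realType}.
Implicit Types f F dF G dG H : R -> R.

(* [exp (- x^2 / 2) G] is nondecreasing, so a positive value of [G] propagates to
   a growth of order [exp (x^2 / 2)]. *)
Lemma gaussian_growth_le0 G dG (x0 A B : R) :
  (forall x, is_derive x (1 : R) G (dG x)) ->
  (forall x, x0 <= x -> x * G x <= dG x) ->
  (forall x, G x <= A + B * `|x|) -> G x0 <= 0.
Proof.
move=> hG dG_ge GAB; rewrite leNgt; apply/negP => G0.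
pose E x := expR (- (x ^+ 2 / 2)) : R.
have dE x : is_derive x (1 : R) E (- x * E x).
  have d : is_derive x (1 : R) (fun y : R => - (y ^+ 2 / 2)) (- x).
    by apply: is_derive_eq; rewrite /GRing.scale /=; field.
  by rewrite /E; apply: is_derive_eq; rewrite /GRing.scale /=; ring.
have mono x : x0 <= x -> G x0 * E x0 <= G x * E x.
  move=> x0x; apply: (@is_derive_ge0_le R (fun y => G y * E y)
      (fun y => (dG y - y * G y) * E y)) => // y /andP[x0y _].
  - have h1 := hG y; have h2 := dE y.
    by apply: is_derive_eq; rewrite /GRing.scale /=; ring.
  - by rewrite mulr_ge0 ?expR_ge0// subr_ge0 dG_ge.
pose d := G x0 * E x0.
have d0 : 0 < d by rewrite mulr_gt0 ?expR_gt0.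
have low x : x0 <= x -> d * (1 + x ^+ 2 / 2) <= G x.
  move=> /mono; rewrite -/d /E expRN ler_pdivlMr ?expR_gt0// => h.
  by apply: le_trans h; rewrite ler_pM2l// expR_ge1Dx.
pose K := `|A| + `|B| + 1.
have K0 : 0 < K by rewrite /K; have := normr_ge0 A; have := normr_ge0 B; lra.
(* This point lies beyond [x0] and 1, and satisfies [d * x >= 2 * K]. There the quadratic lower
   bound on [G] already exceeds [K * x], which is larger than [A + B * x]. *)
pose x := `|x0| + 2 * K / d + 1.
have Kd : 0 < 2 * K / d by apply: divr_gt0 => //; apply: mulr_gt0.
have x1 : 1 <= x by rewrite /x; have := normr_ge0 x0; lra.
have x0x : x0 <= x by rewrite /x; have := ler_norm x0; lra.
have dx : 2 * K <= d * x.
  have e : 2 * K = d * (2 * K / d) by field; rewrite gt_eqF.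
  by rewrite [leLHS]e ler_pM2l// /x; have := normr_ge0 x0; lra.
have h1 := low x x0x; have h2 := GAB x.
have h3 : K * x <= d * (x ^+ 2 / 2) by nra.
rewrite ger0_norm in h2; last by lra.
have h4 : A + B * x < K * x.
  have := ler_norm A; have := ler_norm B; have := normr_ge0 A; have := normr_ge0 B.
  rewrite /K; nra.
lra.
Qed.

Lemma gaussian_growth_le0N G dG (x0 A B : R) :
  (forall x, is_derive x (1 : R) G (dG x)) ->
  (forall x, x <= x0 -> dG x <= x * G x) ->
  (forall x, G x <= A + B * `|x|) -> G x0 <= 0.
Proof.
move=> hG dG_le GAB; rewrite -(opprK x0).
apply: (@gaussian_growth_le0 (fun x => G (- x)) (fun x => - dG (- x)) _ A B) => x.
- have h := hG (- x); have h1 : is_derive x (1 : R) (fun y : R => - y) (-1).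
    by apply: is_derive_eq.
  have h2 := @is_derive1_comp R G (fun y => - y) x _ _ h h1.
  by apply: is_derive_eq; rewrite mulrN1.
- by move=> x0x; rewrite -lerN2 opprK -mulNr dG_le// lerNl.
- by rewrite -normrN.
Qed.

(** For [x >= x0] one has [x * (c / x0) >= c], so [F - c / x0] satisfies the growth inequality of
    [gaussian_growth_le0] and cannot be positive at [x0]. *)
Lemma gaussian_comparison F dF (c x0 A B : R) : 0 <= c -> 0 < x0 ->
  (forall x, is_derive x (1 : R) F (dF x)) ->
  (forall x, x0 <= x -> x * F x - c <= dF x) ->
  (forall x, F x <= A + B * `|x|) -> x0 * F x0 <= c.
Proof.
move=> c0 x00 hF dF_ge FAB; rewrite mulrC -ler_pdivlMr// -subr_le0.
apply: (@gaussian_growth_le0 (fun x => F x - c / x0) dF x0 (A - c / x0) B) => x.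
- have h := hF x; by apply: is_derive_eq; rewrite subr0.
- move=> x0x; apply: le_trans (dF_ge x x0x); rewrite mulrBr lerD2l lerN2.
  by rewrite mulrCA ler_peMr// ler_pdivlMr// mul1r.
- by rewrite addrAC lerD2r.
Qed.

(** Four uses of the one-sided comparison, on [F], [- F] and their reflections. It will be applied
    with [F] the derivative of a Stein solution. *)
Lemma gaussian_comparison_norm F dF (c A B : R) :
  (forall x, is_derive x (1 : R) F (dF x)) ->
  (forall x, `|dF x - x * F x| <= c) ->
  (forall x, `|F x| <= A + B * `|x|) -> forall x, `|x * F x| <= c.
Proof.
move=> hF dFc FAB.
have c0 : 0 <= c by exact: le_trans (dFc 0).
have F1 x : F x <= A + B * `|x| by apply: le_trans (FAB x); exact: ler_norm.
have F2 x : - F x <= A + B * `|x| by apply: le_trans (FAB x); rewrite -normrN ler_norm.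
have hN x : is_derive x (1 : R) (fun y => F (- y)) (- dF (- x)).
  have h := hF (- x); have h1 : is_derive x (1 : R) (fun y : R => - y) (-1).
    by apply: is_derive_eq.
  have h2 := @is_derive1_comp R F (fun y => - y) x _ _ h h1.
  by apply: is_derive_eq; rewrite mulrN1.
move=> x; case: (ltrgt0P x) => x0; last by rewrite x0 mul0r normr0.
- rewrite ler_norml lerNl -mulrN; apply/andP; split.
    apply: (@gaussian_comparison (fun y => - F y) (fun y => - dF y) c x A B) => // y.
    by move=> _; have := dFc y; rewrite ler_norml; lra.
  apply: (@gaussian_comparison F dF c x A B) => // y.
  by move=> _; have := dFc y; rewrite ler_norml; lra.
- have Nx0 : 0 < - x by rewrite oppr_gt0.
  have -> : x * F x = - ((- x) * F (- - x)) by rewrite opprK mulNr opprK.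
  rewrite normrN ler_norml lerNl -mulrN; apply/andP; split.
    apply: (@gaussian_comparison (fun y => - F (- y)) (fun y => dF (- y)) c (- x) A B) => // y.
    - have h := hN y; by apply: is_derive_eq; rewrite opprK.
    - by move=> _; have := dFc (- y); rewrite ler_norml; lra.
    - by rewrite -normrN.
  apply: (@gaussian_comparison (fun y => F (- y)) (fun y => - dF (- y)) c (- x) A B) => // y.
    by move=> _; have := dFc (- y); rewrite ler_norml; lra.
  by rewrite -normrN.
Qed.

(** Since [H x + L * x] is nondecreasing, its position relative to [c] at [x0] persists on one side
    of [x0]. On that side [f - L] obeys the growth inequality, so a positive value at [x0] would
    contradict boundedness. *)
Lemma stein_le_lipschitz f H (c L M : R) :
  (forall x y, `|H y - H x| <= L * `|y - x|) ->
  (forall x, `|f x| <= M) ->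
  (forall x, is_derive x (1 : R) f (x * f x + H x - c)) ->
  forall x, f x <= L.
Proof.
move=> HL fM hf x0; rewrite -subr_le0.
have mono x y : x <= y -> H x + L * x <= H y + L * y.
  rewrite -subr_ge0 => yx; have := HL x y; rewrite (ger0_norm yx) ler_norml; lra.
have dG x : is_derive x (1 : R) (fun y => f y - L) (x * f x + H x - c).
  have h := hf x; by apply: is_derive_eq; rewrite subr0.
have GM x : f x - L <= (M - L) + 0 * `|x|.
  by rewrite mul0r addr0 lerD2r; apply: le_trans (fM x); exact: ler_norm.
case: (leP c (H x0 + L * x0)) => hc.
- apply: (gaussian_growth_le0 dG _ GM) => x /mono; lra.
- apply: (gaussian_growth_le0N dG _ GM) => x /mono; lra.
Qed.

Lemma stein_norm_le f H (c L M : R) :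
  (forall x y, `|H y - H x| <= L * `|y - x|) ->
  (forall x, `|f x| <= M) ->
  (forall x, is_derive x (1 : R) f (x * f x + H x - c)) ->
  forall x, `|f x| <= L.
Proof.
move=> HL fM hf x; rewrite ler_norml lerNl (stein_le_lipschitz HL fM hf) andbT.
apply: (@stein_le_lipschitz (fun y => - f y) (fun y => - H y) (- c) L M) => y.
- by move=> z; rewrite -opprD normrN.
- by rewrite normrN.
- have h := hf y; by apply: is_derive_eq; ring.
Qed.

End stein_ode.

(** * Stein solutions for a convex Lipschitz datum, convexity being expressed by tangent lines *)

Section stein_convex.
Context {R : realType}.
Variables (H psi : R -> R) (L : R).
Hypothesis dH : forall x, is_derive x (1 : R) H (psi x).
Hypothesis psiL : forall x, `|psi x| <= L.
Hypothesis tangent : forall x y, H x + psi x * (y - x) <= H y.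

Lemma tangent_lipschitz x y : `|H y - H x| <= L * `|y - x|.
Proof.
rewrite ler_norml; apply/andP; split.
  have h : `|psi x * (y - x)| <= L * `|y - x| by rewrite normrM ler_wpM2r.
  by have := tangent x y; move: h; rewrite ler_norml; lra.
have h : `|psi y * (x - y)| <= L * `|y - x| by rewrite normrM distrC ler_wpM2r.
by have := tangent y x; move: h; rewrite ler_norml; lra.
Qed.

Lemma tangent_linear_growth x : `|H x| <= `|H 0| + L * `|x|.
Proof.
have := tangent_lipschitz 0 x; rewrite subr0 => h.
by rewrite -[X in `|X|](subrK (H 0)) addrC (le_trans (ler_normD _ _))// lerD2l.
Qed.

Lemma tangent_continuous : continuous H.
Proof. by move=> x; exact: is_derive_continuous (dH x). Qed.

Lemma tangent_tame : tame H.
Proof. exact: linear_growth_tame tangent_continuous tangent_linear_growth. Qed.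

(* Jensen's inequality, through the tangent at [x]. *)
Lemma tangent_std_normal_E x : H x - psi x * x <= std_normal_E H.
Proof.
(* The mean of [Z] comes from integrating by parts against the constant 1. *)
have idE : std_normal_E (fun z : R => z) = 0.
  have := @std_normal_E_ibp R (fun=> 1) (fun=> 0) 1 0 (fun x => is_derive_cst _ _ _)
     (tame_cst 0) _.
  rewrite std_normal_E_cst => <-; first by apply: eq_std_normal_E => z; rewrite mulr1.
  by move=> z; rewrite normr1 mul0r addr0.
have tt : tame (fun z : R => H x - psi x * x + psi x * z).
  by apply: tameD; [exact: tame_cst|apply: tameZ; exact: tame_id].
have := std_normal_E_le tt tangent_tame.
rewrite std_normal_ED; [|exact: tame_cst|by apply: tameZ; exact: tame_id].
rewrite std_normal_E_cst std_normal_EZ; last exact: tame_id.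
rewrite idE mulr0 addr0; apply => z.
by have := tangent x z; rewrite mulrBr; lra.
Qed.

Variables (f : R -> R) (M : R).
Let c := std_normal_E H.
Hypothesis fM : forall x, `|f x| <= M.
Hypothesis df : forall x, is_derive x (1 : R) f (x * f x + H x - c).

(* Subtracting from [H] its tangent at [x0] shifts [f] by a constant. *)
Lemma stein_derive_le0 x0 : x0 * f x0 + H x0 - c <= 0.
Proof.
(* This is the Gaussian mean of [H] minus its tangent at [x0], shifted to vanish with that tangent
   at the origin. Jensen makes it nonnegative, as the comparison lemma demands; this alone settles
   [x0 = 0]. A negative [x0] is handled by reflection. *)
pose c' := c - H x0 + psi x0 * x0.
have c'0 : 0 <= c' by have := tangent_std_normal_E x0; rewrite /c' -/c; lra.
suff : x0 * (f x0 + psi x0) <= c' by rewrite /c'; lra.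
pose A := M + `|psi x0|.
have fA x : `|f x + psi x0| <= A + 0 * `|x|.
  by rewrite mul0r addr0 (le_trans (ler_normD _ _))// lerD2r.
have dg x : is_derive x (1 : R) (fun y => f y + psi x0) (x * f x + H x - c).
  have h := df x; by apply: is_derive_eq; rewrite addr0.
have ge x : x * (f x + psi x0) - c' <= x * f x + H x - c.
  by have := tangent x0 x; rewrite /c' mulrBr; lra.
case: (ltrgt0P x0) => hx0; last by rewrite {1}hx0 mul0r.
- apply: (@gaussian_comparison R (fun y => f y + psi x0) _ c' x0 A 0 c'0 hx0 dg) => x.
    by move=> _; exact: ge.
  by apply: le_trans (fA x); exact: ler_norm.
- rewrite -(opprK x0) mulNr -mulrN opprK.
  have hx1 : 0 < - x0 by rewrite oppr_gt0.
  have := @gaussian_comparison R (fun y => - (f (- y) + psi x0))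
    (fun x => - x * f (- x) + H (- x) - c) c' (- x0) A 0 c'0 hx1.
  rewrite opprK; apply => x.
  + have h := dg (- x); have h1 : is_derive x (1 : R) (fun y : R => - y) (-1).
      by apply: is_derive_eq.
    have h2 := @is_derive1_comp R (fun y => f y + psi x0) (fun y => - y) x _ _ h h1.
    have -> : - x * f (- x) + H (- x) - c
        = - ((- x * f (- x) + H (- x) - c) * (-1)) by rewrite mulrN1 opprK.
    exact: (is_deriveN h2).
  + by move=> _; have := ge (- x); rewrite mulrN mulNr.
  + by rewrite -(normrN x); apply: le_trans (fA (- x)); rewrite -normrN ler_norm.
Qed.

(** Differentiating the equation, [p = f'] satisfies [p' - z * p = f + psi], bounded by [2 * L]. The
    comparison lemma bounds [z * p] by [2 * L] too, so [|p'| <= 4 * L], and the mean value theorem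
    concludes. *)
Lemma stein_derive_lipschitz x y :
  `|(y * f y + H y - c) - (x * f x + H x - c)| <= 4 * L * `|y - x|.
Proof.
pose p z := z * f z + H z - c.
pose q z := f z + z * p z + psi z.
have dp z : is_derive z (1 : R) p (q z).
  have h1 := df z; have h2 := dH z.
  by rewrite /p; apply: is_derive_eq; rewrite /GRing.scale /= /q /p; ring.
have fL := stein_norm_le tangent_lipschitz fM df.
have pgrow z : `|p z| <= (`|H 0| + `|c|) + (2 * L) * `|z|.
  rewrite /p (le_trans (ler_normB _ _))// (le_trans (lerD (ler_normD _ _) (lexx _)))//.
  rewrite normrM.
  have h := tangent_linear_growth z.
  have h2 : `|z| * `|f z| <= L * `|z| by rewrite mulrC ler_wpM2r.
  lra.
have qb z : `|q z - z * p z| <= 2 * L.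
  rewrite (_ : q z - _ = f z + psi z); last by rewrite /q; ring.
  by rewrite (le_trans (ler_normD _ _))//; have := fL z; have := psiL z; lra.
have xp := gaussian_comparison_norm dp qb pgrow.
have qL z : `|q z| <= 4 * L.
  have -> : q z = (q z - z * p z) + z * p z by ring.
  by rewrite (le_trans (ler_normD _ _))//; have := qb z; have := xp z; lra.
wlog xy : x y / x <= y.
  move=> wl; case: (leP x y) => [/wl//|/ltW/wl].
  by rewrite distrC (distrC x y).
have [z _ ->] := is_derive_MVT xy (fun t _ => dp t).
by rewrite normrM ler_wpM2r.
Qed.

End stein_convex.

(** * One round of the Stein algorithm *)

Section stein_round.
Context {R : realType}.
Variables (h psi : R -> R).
Hypothesis dh : forall x, is_derive x (1 : R) h (psi x).
Hypothesis psi1 : forall x, `|psi x| <= 1.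
Hypothesis tangent : forall x y, h x + psi x * (y - x) <= h y.

(** With [z = (x - mu) / sigma], the function [sigma * f (mu + sigma * z)] solves the standard
    equation for a datum of Lipschitz constant [sigma]. Scaling [4 * sigma] back costs [sigma ^+ 3],
    which leaves [4 / sigma ^+ 2]. *)
Lemma stein_solution_spec (mu sigma : R) : 0 < sigma ->
  let f := stein_solution h mu sigma in
  let c := std_normal_E (fun z => h (mu + sigma * z)) in
  let df x := ((x - mu) * f x + h x - c) / sigma ^+ 2 in
  [/\ exists M, forall x, `|f x| <= M,
      forall x, is_derive x (1 : R) f (df x),
      forall x, df x <= 0 &
      forall x y, `|df y - df x| <= 4 / sigma ^+ 2 * `|y - x|].
Proof.
move=> s0 f c df; have sn0 : sigma != 0 by rewrite gt_eqF.
pose H z := h (mu + sigma * z); pose PSI z := sigma * psi (mu + sigma * z).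
have daff z : is_derive z (1 : R) (fun y : R => mu + sigma * y) sigma.
  by apply: is_derive_eq; rewrite /GRing.scale /=; ring.
have dH z : is_derive z (1 : R) H (PSI z).
  have h1 := @is_derive1_comp R h (fun y => mu + sigma * y) z _ _ (dh _) (daff z).
  by apply: is_derive_eq; rewrite /PSI mulrC.
have PSI1 z : `|PSI z| <= sigma by rewrite normrM (gtr0_norm s0) ler_piMr// ltW.
have tanH x y : H x + PSI x * (y - x) <= H y.
  by have := tangent (mu + sigma * x) (mu + sigma * y); rewrite /H /PSI; nra.
(* Existence guarantees that [stein_solution] is a true solution rather than the default 0 of
   [xget]. *)
have ex : exists g, bounded_stein_solution h mu sigma g.
  have [f0 [/bounded_funPn[M fM] df0]] :=
    std_stein_existence (tangent_continuous dH) (tangent_linear_growth PSI1 tanH).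
  have dsc (x : R) : is_derive x (1 : R) (fun y : R => (y - mu) / sigma) sigma^-1.
    by apply: is_derive_eq; rewrite /GRing.scale /=; ring.
  exists (fun x => f0 ((x - mu) / sigma) / sigma); split.
    apply/bounded_funPn; exists (M / sigma) => x.
    by rewrite normf_div (gtr0_norm s0) ler_pM2r ?invr_gt0.
  move=> x; have h1 := @is_derive1_comp R f0 _ x _ _ (df0 _) (dsc x).
  pose z := (x - mu) / sigma.
  have : is_derive x (1 : R) (fun y => f0 ((y - mu) / sigma) / sigma)
     ((z * f0 z + H z - std_normal_E H) * sigma^-1 / sigma).
    by apply: is_derive_eq; rewrite /GRing.scale /= -/z; ring.
  move=> [d1 d2]; split => //; rewrite derive1E d2.
  have -> : h x = H z by rewrite /H /z mulrC divfK// addrC subrK.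
  by rewrite -/z /H; have -> : x - mu = z * sigma by [rewrite divfK]; field.
have [fb fsol] : bounded_stein_solution h mu sigma f by exact: xgetPex.
have [M fM] := (bounded_funPn f).1 fb.
have dfE x : is_derive x (1 : R) f (df x).
  have [d1 d2] := fsol x; apply: DeriveDef; first exact: d1.
  rewrite -derive1E /df; move: d2; rewrite -/f -/c => d2.
  have -> : (x - mu) * f x + h x - c = sigma ^+ 2 * derive1 f x by lra.
  by field.
pose f1 z := sigma * f (mu + sigma * z).
have f1M z : `|f1 z| <= sigma * M.
  by rewrite normrM (gtr0_norm s0) ler_wpM2l// ltW.
have df1 z : is_derive z (1 : R) f1 (z * f1 z + H z - c).
  have h1 := @is_derive1_comp R f _ z _ _ (dfE _) (daff z).
  rewrite /f1; apply: is_derive_eq; rewrite /GRing.scale /= /df /H.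
  by field.
have dfz x : df x = ((x - mu) / sigma * f1 ((x - mu) / sigma)
    + H ((x - mu) / sigma) - c) / sigma ^+ 2.
  have e : mu + sigma * ((x - mu) / sigma) = x by field.
  by rewrite /df /f1 /H e; field.
split => //.
- by exists M.
- move=> x; rewrite dfz pmulr_lle0 ?invr_gt0 ?exprn_gt0//.
  exact: (stein_derive_le0 dH PSI1 tanH f1M df1).
- move=> x y; rewrite !dfz -mulrBl normrM.
  have s2 : 0 < sigma ^- 2 by rewrite invr_gt0 exprn_gt0.
  rewrite (gtr0_norm s2) [leRHS]mulrAC ler_pM2r//.
  have := stein_derive_lipschitz dH PSI1 tanH f1M df1 ((x - mu) / sigma) ((y - mu) / sigma).
  have -> : (y - mu) / sigma - (x - mu) / sigma = (y - x) / sigma by field.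
  rewrite normf_div (gtr0_norm s0).
  by have -> : 4 * sigma * (`|y - x| / sigma) = 4 * `|y - x| by field.
Qed.

(** By the mean value theorem the left side is [df (w + g) - g ^+ 2 * df z] with [z] between [w] and
    [w + g]. It equals [(1 - g ^+ 2) * df (w + g)], which is nonpositive, plus
    [g ^+ 2 * (df (w + g) - df z)], which is at most [L]. *)
Lemma stein_one_step f (L g w : R) (df : R -> R) :
  (forall x, is_derive x (1 : R) f (df x)) -> (forall x, df x <= 0) ->
  (forall x y, `|df y - df x| <= L * `|y - x|) -> `|g| <= 1 ->
  df (w + g) - g * (f (w + g) - f w) <= L.
Proof.
move=> hf df0 dfL g1.
have L0 : 0 <= L by have := dfL 0 1; rewrite subr0 normr1 mulr1; exact: le_trans.
have [z zg fE] : exists2 z, `|w + g - z| <= 1 & f (w + g) - f w = df z * g.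
  move: g1; rewrite ler_norml => /andP[g1 g2].
  case: (leP 0 g) => g0.
    have [|z /andP[z1 z2] fE] := @is_derive_MVT R f df w (w + g) _ (fun x _ => hf x); first lra.
    exists z; first by rewrite ler_norml; lra.
    by rewrite fE; ring.
  have [|z /andP[z1 z2] fE] := @is_derive_MVT R f df (w + g) w _ (fun x _ => hf x); first lra.
  exists z; first by rewrite ler_norml; lra.
  by rewrite -[LHS]opprB fE; ring.
rewrite fE.
have g2 : g ^+ 2 <= 1 by rewrite -(real_normK (num_real g)) expr_le1.
have h1 : df (w + g) - df z <= L.
  rewrite (le_trans (ler_norm _))// (le_trans (dfL _ _))//.
  by rewrite ler_piMr.
have := df0 (w + g); have := df0 z; have := sqr_ge0 g; nra.
Qed.

(** The loss of a round is paid by the decrease of the smoothed potential, up to the one-step error.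
    The value [r = 0] is allowed since the last round uses [rho T = 0]. *)
Lemma stein_round (s g sigma r : R) : 0 < sigma -> 0 <= r ->
  sigma ^+ 2 = r ^+ 2 + 1 -> `|g| <= 1 ->
  g * std_normal_E (fun z => stein_solution h s sigma (s + r * z))
  <= std_normal_E (fun z => h (s + sigma * z))
     - std_normal_E (fun z => h (s + g + r * z)) + 4 / sigma ^+ 2.
Proof.
move=> s0 r0 sr g1; have [] := stein_solution_spec s s0.
set f := stein_solution h s sigma; set c := std_normal_E _.
pose df x := ((x - s) * f x + h x - c) / sigma ^+ 2.
move=> [M fM] hf0 df00 dfL0.
have hf x : is_derive x (1 : R) f (df x) := hf0 x.
have df0 x : df x <= 0 := df00 x.
have dfL x y : `|df y - df x| <= 4 / sigma ^+ 2 * `|y - x| := dfL0 x y.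
have tf : tame f.
  split=> [x|]; first exact: is_derive_continuous (hf x).
  exists M => x; apply: le_trans (fM x) _; rewrite ler_peMr ?lerDl ?sqr_ge0//.
  exact: le_trans (fM 0).
have th : tame h by exact: tangent_tame dh psi1 tangent.
have tdf : tame df.
  have t1 : tame (fun x => x * f x).
    apply: (@linear_growth_tame R _ 0 M) => [x|x].
      by apply: cvgM; [exact: cvg_id|exact: tf.1].
    by rewrite add0r normrM mulrC ler_wpM2r.
  have := tameZ (sigma ^- 2) (tameB (tameD (tameB t1 (tameZ s tf)) th) (tame_cst c)).
  by congr tame; apply/funext => x; rewrite /df; ring.
pose W z := s + g + r * z; pose U z := s + r * z.
have tW F : tame F -> tame (fun z => F (W z)) by exact: tame_comp_affine.
have tU F : tame F -> tame (fun z => F (U z)) by exact: tame_comp_affine.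
have step z : df (W z) - g * (f (W z) - f (U z)) <= 4 / sigma ^+ 2.
  have -> : W z = U z + g by rewrite /W /U; ring.
  exact: stein_one_step.
have tdiff : tame (fun z => f (W z) - f (U z)) by apply: tameB; [exact: tW|exact: tU].
have E1 : std_normal_E (fun z => df (W z))
    - g * (std_normal_E (fun z => f (W z)) - std_normal_E (fun z => f (U z)))
    <= 4 / sigma ^+ 2.
  rewrite -std_normal_EB; [|exact: tW|exact: tU].
  rewrite -std_normal_EZ// -std_normal_EB; [|exact: tW|exact: tameZ].
  rewrite -[leRHS]std_normal_E_cst; apply: std_normal_E_le => //; last exact: tame_cst.
  by apply: tameB; [exact: tW|exact: tameZ].
have ibp : std_normal_E (fun z => z * f (W z)) = r * std_normal_E (fun z => df (W z)).
  rewrite -std_normal_EZ; last exact: tW.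
  apply: (@std_normal_E_ibp R _ _ M 0) => [x||x].
  - have daff : is_derive x (1 : R) W r.
      by rewrite /W; apply: is_derive_eq; rewrite /GRing.scale /=; ring.
    have h1 := @is_derive1_comp R f _ x _ _ (hf _) daff.
    by apply: is_derive_eq; rewrite mulrC.
  - by apply: tameZ; exact: tW.
  - by rewrite mul0r addr0.
have tzf : tame (fun z => z * f (W z)).
  apply: (@linear_growth_tame R _ 0 M) => [x|x].
    by apply: cvgM; [exact: cvg_id|exact: (tW _ tf).1].
  by rewrite add0r normrM mulrC ler_wpM2r.
have sn0 : sigma != 0 by rewrite gt_eqF.
(* Expectation of the Stein equation at [W z], where [W z - s = g + r * z]. After [ibp], the term in
   [r] becomes [r ^+ 2] times the expectation on the left, and [sigma ^+ 2 - r ^+ 2 = 1] leaves that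
   expectation with coefficient 1. *)
have key : sigma ^+ 2 * std_normal_E (fun z => df (W z)) =
   g * std_normal_E (fun z => f (W z)) + r * std_normal_E (fun z => z * f (W z))
   + std_normal_E (fun z => h (W z)) - c.
  rewrite -std_normal_EZ; last exact: tW.
  have tfW := tW _ tf; have thW := tW _ th.
  rewrite -(std_normal_EZ g)// -(std_normal_EZ r)//.
  rewrite -std_normal_ED; [|exact: tameZ|exact: tameZ].
  rewrite -std_normal_ED//; last by apply: tameD; exact: tameZ.
  rewrite -[X in _ - X]std_normal_E_cst -std_normal_EB; last 2 first.
  - by apply: tameD => //; apply: tameD; exact: tameZ.
  - exact: tame_cst.
  by apply: eq_std_normal_E => z; rewrite /df /W; field.
move: key; rewrite ibp sr => key; move: E1; rewrite -/U -/W sr.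
set P := std_normal_E (fun z => df (W z)) in key *.
set Q := std_normal_E (fun z => f (W z)) in key *.
rewrite -/(W _); nra.
Qed.

End stein_round.

(** * The Huber function *)

(** The difference quotient is within [C * |t|] of [d]. This form treats the junction points of the
    Huber function like all others. *)
Lemma is_derive_quadratic_error (R : realType) (f : R -> R) (x d C : R) :
  (forall y, `|f y - f x - d * (y - x)| <= C * (y - x) ^+ 2) ->
  is_derive x (1 : R) f d.
Proof.
move=> fC.
have lim : (fun t => t^-1 *: (f (t *: (1 : R) + x) - f x)) @ (0 : R)^' --> d.
  have C0 : 0 <= C.
    by have := fC (x + 1); rewrite [x + 1]addrC addrK expr1n !mulr1; exact: le_trans.
  apply/cvgrPdist_le => e e0; near=> t.
  have t0 : t != 0 by near: t; exact: nbhs_dnbhs_neq.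
  (* Adding 1 keeps the denominator positive when [C = 0]. *)
  have te : `|t| <= e / (C + 1).
    near: t; apply: dnbhs0_le; rewrite divr_gt0//; lra.
  rewrite /GRing.scale /= mulr1.
  have -> : d - t^-1 * (f (t + x) - f x) = - (t^-1 * (f (t + x) - f x - d * (t + x - x))).
    by field.
  rewrite normrN normrM normfV ler_pdivrMl ?normr_gt0//.
  apply: le_trans (fC _) _; rewrite addrK -(real_normK (num_real t)).
  rewrite ler_pdivlMr in te; last lra.
  have := normr_ge0 t; nra.
by apply: DeriveDef; [apply/cvg_ex; exists d|exact: cvg_lim].
Unshelve. all: by end_near. Qed.

Section huber.
Context {R : realType}.
Variable eta : R.
Hypothesis eta0 : 0 < eta.

(** This is [eta * x] clipped to the interval from -1 to 1. *)
Definition huber_slope (x : R) : R :=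
  if `|x| <= eta^-1 then eta * x else Num.sg x.

Lemma huber_slope_norm x : `|huber_slope x| <= 1.
Proof.
rewrite /huber_slope; case: ifP => [hx|_]; last by rewrite normr_sg lern1 leq_b1.
by rewrite normrM (gtr0_norm eta0) -ler_pdivlMl// mulr1.
Qed.

(** The equality case of Fenchel-Young: the conjugate of the Huber function is [u ^+ 2 / (2 * eta)]
    for [|u| <= 1]. *)
Lemma huber_slopeE x : huber eta x = huber_slope x * x - huber_slope x ^+ 2 / (2 * eta).
Proof.
have en : eta != 0 by rewrite gt_eqF.
rewrite /huber /huber_slope; case: ifP => hx; first by field.
have x0 : x != 0.
  by apply: contraFN hx => /eqP ->; rewrite normr0 invr_ge0 ltW.
by rewrite sqr_sg x0 /= -normrEsg; field.
Qed.

Lemma huber_ge_affine u x : `|u| <= 1 -> u * x - u ^+ 2 / (2 * eta) <= huber eta x.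
Proof.
move=> u1; have en : eta != 0 by rewrite gt_eqF.
have b0 : 0 < eta^-1 by rewrite invr_gt0.
rewrite /huber invfM; have : eta * eta^-1 = 1 by rewrite divff.
move: b0; set b := eta^-1 => b0 eb; case: (leP `|x| b) => hx.
  rewrite -subr_ge0.
  have -> : eta / 2 * x ^+ 2 - (u * x - u ^+ 2 * (2^-1 * b)) = eta / 2 * (x - u * b) ^+ 2.
    have -> : u * x = eta * b * (u * x) by rewrite eb mul1r.
    have -> : u ^+ 2 * (2^-1 * b) = eta * b * (u ^+ 2 * (2^-1 * b)) by rewrite eb mul1r.
    by field.
  by rewrite mulr_ge0 ?sqr_ge0// divr_ge0// ltW.
have : u * x <= `|u| * `|x| by rewrite -normrM ler_norm.
rewrite -[u ^+ 2](real_normK (num_real u)).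
have := normr_ge0 u; move: u1 hx; set v := `|u|; set n := `|x| => v1 nb v0 ux.
(* On the linear branch, the gap for aligned signs is [(1 - v) * (n - b) + (1 - v) ^+ 2 * b / 2]. *)
have : 0 <= (1 - v) * (n - b) by rewrite mulr_ge0; lra.
have : 0 <= (1 - v) ^+ 2 * b by rewrite mulr_ge0 ?sqr_ge0// ltW.
nra.
Qed.

Lemma huber_tangent x y : huber eta x + huber_slope x * (y - x) <= huber eta y.
Proof.
apply: le_trans (huber_ge_affine y (huber_slope_norm x)).
by rewrite huber_slopeE; lra.
Qed.

Lemma huber_slope_lipschitz x y : x <= y ->
  huber_slope y - huber_slope x <= eta * (y - x).
Proof.
move=> xy; have en : eta != 0 by rewrite gt_eqF.
have b0 : 0 < eta^-1 by rewrite invr_gt0.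
have : eta * eta^-1 = 1 by rewrite divff.
rewrite /huber_slope; move: b0; set b := eta^-1 => b0 eb.
have h z w : z <= w -> eta * z <= eta * w by rewrite ler_pM2l.
case: (lerP `|x| b); case: (lerP `|y| b); rewrite ?ler_norml ?ltr_normr.
- by lra.
- move=> /orP[hy|hy] /andP[x1 x2].
    by rewrite gtr0_sg; [have := h _ _ (ltW hy); lra|lra].
  by rewrite ltr0_sg; [have := h _ _ (ltW hy); lra|lra].
- move=> /andP[y1 y2] /orP[hx|hx].
    by rewrite gtr0_sg; [have := h _ _ (ltW hx); lra|lra].
  by rewrite ltr0_sg; [have := h _ _ (ltW hx); lra|lra].
- move=> /orP[hy|hy] /orP[hx|hx].
  + by rewrite !gtr0_sg; [have := h _ _ xy; lra|lra|lra].
  + rewrite gtr0_sg; last lra.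
    rewrite ltr0_sg; last lra.
    by have := h _ _ (ltW hx); have := h _ _ (ltW hy); lra.
  + by lra.
  + by rewrite !ltr0_sg; [have := h _ _ xy; lra|lra|lra].
Qed.

(** The tangents at [x] and at [y] place the remainder between 0 and the slope increment times
    [y - x], which is at most [eta * (y - x) ^+ 2]. *)
Lemma is_derive_huber x : is_derive x (1 : R) (huber eta) (huber_slope x).
Proof.
apply: (@is_derive_quadratic_error _ _ _ _ eta) => y.
have h1 := huber_tangent x y; have h2 := huber_tangent y x.
rewrite ger0_norm; last by lra.
apply: (@le_trans _ _ ((huber_slope y - huber_slope x) * (y - x))); first by lra.
rewrite expr2 mulrA; case: (leP x y) => xy.
  by rewrite ler_wpM2r ?subr_ge0// huber_slope_lipschitz.
rewrite ler_wnM2r ?subr_le0 ?(ltW xy)//.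
by have := huber_slope_lipschitz (ltW xy); lra.
Qed.

Lemma tame_huber : tame (huber eta).
Proof. exact: tangent_tame is_derive_huber huber_slope_norm huber_tangent. Qed.

End huber.

(** * Gaussian expectation of the Huber function *)

Section huber_expectation.
Context {R : realType}.
Notation mu := (@lebesgue_measure R).
Notation phi := (@std_normal_pdf R).
Notation Phi := (@std_normal_cdf R).

Lemma huber_scale (s alpha z : R) : 0 < s -> 0 < alpha ->
  huber (alpha / s) (s * z) = s * huber alpha z.
Proof.
move=> s0 a0; have sn : s != 0 by rewrite gt_eqF.
have an : alpha != 0 by rewrite gt_eqF.
rewrite /huber normrM (gtr0_norm s0) invf_div.
have -> : (s * `|z| <= s / alpha) = (`|z| <= alpha^-1) by rewrite ler_pM2l.
by case: ifP => _; field; rewrite ?sn ?an.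
Qed.

Lemma integrable_std_normal_pdf : mu.-integrable [set: R] (EFin \o phi).
Proof. exact: integrable_normal_pdf. Qed.

Lemma is_derive_std_normal_cdf (x : R) : is_derive x (1 : R) Phi (phi x).
Proof.
exact: is_derive_Rintegral_itvNy integrable_std_normal_pdf continuous_std_normal_pdf.
Qed.

Lemma std_normal_cdf_cvgy : Phi x @[x --> +oo] --> (1 : R).
Proof.
have [_] := Rintegral_itvNy_cvg integrable_std_normal_pdf.
have -> : \int[mu]_x phi x = 1 by rewrite /Rintegral integral_normal_pdf.
by [].
Qed.

Lemma std_normal_pdfN (x : R) : phi (- x) = phi x.
Proof. by rewrite !std_normal_pdfE sqrrN. Qed.

Lemma std_normal_E_sqr : std_normal_E (fun z : R => z ^+ 2) = 1.
Proof.
rewrite -[RHS](std_normal_E_cst (1 : R)).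
rewrite -(@std_normal_E_ibp R (fun z => z) (fun=> 1) 0 1).
- by apply: eq_std_normal_E => z; rewrite expr2.
- exact: tame_cst.
- by move=> x; rewrite add0r mul1r.
Qed.

Lemma integral_tail_sqr (a : R) :
  (\int[mu]_(x in `[a, +oo[) ((x - a) ^+ 2 * phi x)%:E
  = ((1 + a ^+ 2) * (1 - Phi a) - a * phi a)%:E)%E.
Proof.
(* A primitive of [(x - a) ^+ 2 * phi x], found from [phi' = - x * phi]; its limit at [+oo] is
   [1 + a ^+ 2]. *)
pose G x := (1 + a ^+ 2) * Phi x + (2 * a - x) * phi x.
have dG x : is_derive x (1 : R) G ((x - a) ^+ 2 * phi x).
  have h1 := is_derive_std_normal_cdf x; have h2 := @is_derive_std_normal_pdf R x.
  by rewrite /G; apply: is_derive_eq; rewrite /GRing.scale /=; ring.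
have Gy : G x @[x --> +oo] --> (1 + a ^+ 2).
  rewrite -[X in _ --> X](_ : (1 + a ^+ 2) * 1 + 0 = _); last by rewrite mulr1 addr0.
  apply: cvgD; first by apply: cvgM; [exact: cvg_cst|exact: std_normal_cdf_cvgy].
  apply: (@linear_growth_pdf_cvg0 R (fun x => 2 * a - x) `|2 * a| 1 _).2 => x.
  by rewrite mul1r ler_normB.
have cG : continuous G by move=> x; exact: is_derive_continuous (dG x).
rewrite (@ge0_continuous_FTC2y R _ G a (1 + a ^+ 2)) => //.
- by rewrite /G -EFinB; congr EFin; ring.
- by move=> x _; rewrite mulr_ge0 ?sqr_ge0// ltW// std_normal_pdf_gt0.
- apply: continuous_subspaceT => x; apply: cvgM; last exact: continuous_std_normal_pdf.
  apply: (@is_derive_continuous R (fun y => (y - a) ^+ 2) x (2 * (x - a))).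
  by apply: is_derive_eq; rewrite /GRing.scale /=; ring.
- by apply: cvg_at_right_filter; exact: cG.
- by move=> x _; rewrite derive1E; have [_ ->] := dG x.
Qed.

(* [huber alpha z = alpha / 2 (z^2 - (|z| - a)_+^2)] with [a = 1 / alpha]. *)
Lemma std_normal_E_huber (alpha : R) : 0 < alpha ->
  std_normal_E (huber alpha) =
    (alpha + alpha^-1) * Phi alpha^-1 + phi alpha^-1 - alpha / 2 - alpha^-1.
Proof.
move=> a0; have an : alpha != 0 by rewrite gt_eqF.
have th := tame_huber a0; have t2 := @tame_sqr R.
pose a := alpha^-1; have a1 : 0 < a by rewrite invr_gt0.
pose m z := z ^+ 2 - 2 / alpha * huber alpha z.
have tm : tame m by apply: tameB => //; exact: tameZ.
have mE z : m z = if `|z| <= a then 0 else (`|z| - a) ^+ 2.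
  rewrite /m /huber -/a; case: ifP => _; first by rewrite /a; field.
  by rewrite -(real_normK (num_real z)) /a; field.
have m0 z : 0 <= m z by rewrite mE; case: ifP => // _; exact: sqr_ge0.
have int_m : (\int[mu]_x (m x * phi x)%:E =
    2%:E * ((1 + a ^+ 2) * (1 - Phi a) - a * phi a)%:E)%E.
  rewrite ge0_symfun_integralT.
  - congr (_ * _)%E; rewrite -integral_tail_sqr integral_mkcond [RHS]integral_mkcond.
    apply: eq_integral => x _; rewrite !patchE.
    have -> : (x \in [set x | 0 <= x]) = (0 <= x) by apply/idP/idP; rewrite inE.
    have -> : (x \in `[a, +oo[%classic) = (a <= x).
      by apply/idP/idP; rewrite inE /= in_itv /= andbT.
    case: (leP 0 x) => x0; last by rewrite ifF//; apply/negbTE; rewrite -ltNge; lra.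
    rewrite mE (ger0_norm x0); case: (ltrgtP x a) => // xa.
      by rewrite mul0r.
    by rewrite xa subrr expr0n.
  - by move=> x; rewrite mulr_ge0// ltW// std_normal_pdf_gt0.
  - move=> x; apply: cvgM; first exact: tm.1.
    exact: continuous_std_normal_pdf.
  - by move=> x /=; rewrite !mE normrN std_normal_pdfN.
have : std_normal_E m = 2 * ((1 + a ^+ 2) * (1 - Phi a) - a * phi a).
  by rewrite std_normal_E_pdf// /Rintegral int_m.
rewrite std_normal_EB//; last exact: tameZ.
rewrite std_normal_EZ// std_normal_E_sqr => h.
have -> : std_normal_E (huber alpha)
    = alpha / 2 * (1 - (1 - 2 / alpha * std_normal_E (huber alpha))) by field.
by rewrite h -/a /a; field.
Qed.

End huber_expectation.

(** * The regret bound *)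

Section olo.
Context {R : realType}.
Variables (A : @olo_algorithm R) (B : @olo_adversary R).

(** The move is read off the shortest play that contains it. Longer plays extend shorter ones, so
    the number of rounds played drops out of the regret sum. *)
Definition olo_reply (t : nat) : R := olo_g A B t.+1 t.

Lemma olo_play_size n :
  size (olo_play A B n).1 = n /\ size (olo_play A B n).2 = n.
Proof.
elim: n => //= n; case: (olo_play A B n) => xs gs /= [hx hg].
by rewrite !size_rcons hx hg.
Qed.

Lemma olo_playS n : olo_play A B n.+1 =
  (rcons (olo_play A B n).1 (A (olo_play A B n).2),
   rcons (olo_play A B n).2 (B (rcons (olo_play A B n).1 (A (olo_play A B n).2)))).
Proof. by rewrite /=; case: (olo_play A B n). Qed.

Lemma olo_play_replies n : (olo_play A B n).2 = mkseq olo_reply n.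
Proof.
elim: n => // n IH; rewrite olo_playS /= -[in RHS]addn1 /mkseq iotaD map_cat /=.
rewrite -/(mkseq _ _) -IH cats1 add0n; congr rcons.
by rewrite /olo_reply /olo_g olo_playS /= nth_rcons (olo_play_size n).2 ltnn eqxx.
Qed.

Lemma olo_gE T t : (t < T)%N -> olo_g A B T t = olo_reply t.
Proof. by move=> tT; rewrite /olo_g olo_play_replies nth_mkseq. Qed.

Lemma olo_xE T t : (t < T)%N -> olo_x A B T t = A (mkseq olo_reply t).
Proof.
elim: T => // T IH; rewrite ltnS leq_eqVlt /olo_x olo_playS /= nth_rcons.
rewrite (olo_play_size T).1 => /predU1P[->|tT]; last by rewrite tT; exact: IH.
by rewrite ltnn eqxx olo_play_replies.
Qed.

Lemma olo_regretE T u : olo_regret A B T u =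
  \sum_(t < T) olo_reply t * (A (mkseq olo_reply t) - u).
Proof. by apply: eq_bigr => t _; rewrite olo_gE// olo_xE. Qed.

End olo.

(** After reversing the sum, induct: [ln (1 - x) <= - x] at [x = (n + 1)^-1] shows that each new
    term is at most [ln (n + 1) - ln n]. *)
Lemma harmonic_le_ln (R : realType) (T : nat) : (0 < T)%N ->
  \sum_(t < T) (T - t)%:R^-1 <= 1 + ln T%:R :> R.
Proof.
move=> T0; rewrite (reindex_inj rev_ord_inj) /=.
have -> : \sum_(t < T) (T - (T - t.+1))%:R^-1 = \sum_(t < T) t.+1%:R^-1 :> R.
  by apply: eq_bigr => t _; rewrite subKn.
elim: T T0 => // -[_ _|T IH _].
  by rewrite big_ord1 invr1 ln1 addr0.
rewrite big_ord_recr /=; have {}IH := IH isT.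
set n : R := T.+1%:R in IH *; have n0 : 0 < n by rewrite ltr0n.
have -> : T.+2%:R = n + 1 :> R by rewrite -natr1.
have n1 : 0 < n + 1 by lra.
suff : (n + 1)^-1 <= ln (n + 1) - ln n by lra.
rewrite -ln_div ?posrE// -lerN2 -lnV ?posrE ?divr_gt0// invf_div.
have -> : n / (n + 1) = 1 + - (n + 1)^-1 by field; rewrite gt_eqF.
by apply: le_ln1Dx; rewrite ltrN2 invf_lt1//; lra.
Qed.

(** * Telescoping the smoothed potential over the rounds *)

Section stein_regret.
Context {R : realType}.
Variables (h psi : R -> R).
Hypothesis dh : forall x, is_derive x (1 : R) h (psi x).
Hypothesis psi1 : forall x, `|psi x| <= 1.
Hypothesis tangent : forall x y, h x + psi x * (y - x) <= h y.

Lemma stein_regret (T : nat) (B : olo_adversary) (u : R) : (1 <= T)%N ->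
  let A := stein_algorithm h (fun t => Num.sqrt (T - t)%:R) in
  (forall t, (t < T)%N -> `|olo_g A B T t| <= 1) ->
  exists s, olo_regret A B T u <=
    std_normal_E (fun z => h (Num.sqrt T%:R * z)) - h s - u * s
    + 4 * (1 + ln T%:R).
Proof.
move=> T0 A gB; pose g := olo_reply A B; pose S t := \sum_(i < t) g i.
pose rho t : R := Num.sqrt (T - t)%:R.
pose V t := std_normal_E (fun z => h (S t + rho t * z)).
exists (S T).
have round (t : 'I_T) : g t * A (mkseq g t) <= V t - V t.+1 + 4 * (T - t)%:R^-1.
  have tT := ltn_ord t.
  have rho2 : rho t ^+ 2 = (T - t)%:R by rewrite sqr_sqrtr.
  have sE : \sum_(x <- mkseq g t) x = S t.
    by rewrite big_map /S -(big_mkord xpredT g) /index_iota subn0.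
  have St1 : S t.+1 = S t + g t by rewrite /S big_ord_recr.
  have := @stein_round R h psi dh psi1 tangent (S t) (g t) (rho t) (rho t.+1).
  rewrite rho2 -St1 /A /stein_algorithm size_mkseq /= sE; apply.
  - by rewrite sqrtr_gt0 ltr0n subn_gt0.
  - exact: sqrtr_ge0.
  - by rewrite sqr_sqrtr// natr1 subnSK.
  - by rewrite /g -(olo_gE _ _ tT); exact: gB.
have Vtel : \sum_(t < T) (V t - V t.+1) = V 0%N - V T.
  rewrite -(big_mkord xpredT (fun t => V t - V t.+1)).
  rewrite -opprB -(telescope_sumr V (leq0n T)) -sumrN.
  by apply: eq_bigr => t _; rewrite opprB.
have V0 : V 0%N = std_normal_E (fun z => h (Num.sqrt T%:R * z)).
  by apply: eq_std_normal_E => z; rewrite /S big_ord0 add0r /rho subn0.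
(* Since [rho T = 0], no smoothing is left after the last round. *)
have VT : V T = h (S T).
  rewrite -[RHS]std_normal_E_cst; apply: eq_std_normal_E => z.
  by rewrite /rho subnn sqrtr0 mul0r addr0.
have regretE : olo_regret A B T u = \sum_(t < T) g t * A (mkseq g t) - u * S T.
  rewrite olo_regretE /S mulr_sumr -sumrB; apply: eq_bigr => t _.
  by rewrite mulrBr [u * _]mulrC.
have : \sum_(t < T) g t * A (mkseq g t)
    <= \sum_(t < T) (V t - V t.+1 + 4 * (T - t)%:R^-1) by exact: ler_sum.
rewrite big_split /= Vtel -mulr_sumr V0 VT.
by have := harmonic_le_ln R T0; rewrite regretE; lra.
Qed.

End stein_regret.

Theorem corollary2 (R : realType) :
  exists C : R,
  forall (T : nat) (alpha : R), (1 <= T)%N -> 0 < alpha ->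
  let eta := alpha / Num.sqrt T%:R in
  let rho := fun t : nat => Num.sqrt (T - t)%:R in
  let A := stein_algorithm (huber eta) rho in
  forall B : olo_adversary,
  (forall t : nat, (t < T)%N -> `|olo_g A B T t| <= 1) ->
  forall u : R, -1 <= u <= 1 ->
  olo_regret A B T u <=
    (u ^+ 2 / (2 * alpha) + (alpha + alpha^-1) * std_normal_cdf alpha^-1
      + std_normal_pdf alpha^-1 - alpha / 2 - alpha^-1) * Num.sqrt T%:R
    + C * (1 + ln T%:R).
Proof.
exists 4 => T alpha T1 alpha0 eta rho A B gB u u1.
have T0 : 0 < Num.sqrt T%:R :> R by rewrite sqrtr_gt0 ltr0n.
have eta0 : 0 < eta by rewrite divr_gt0.
have [s] := stein_regret (is_derive_huber eta0) (huber_slope_norm eta0)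
  (huber_tangent eta0) u T1 gB.
have -> : std_normal_E (fun z => huber eta (Num.sqrt T%:R * z))
    = Num.sqrt T%:R * std_normal_E (huber alpha).
  rewrite -std_normal_EZ; last exact: tame_huber.
  by apply: eq_std_normal_E => z; exact: huber_scale.
rewrite std_normal_E_huber// => /le_trans; apply.
(* Fenchel-Young is used with slope [- u], because the remaining term is [- huber eta s - u * s]. *)
have Nu1 : `|- u| <= 1 by rewrite normrN ler_norml.
have := huber_ge_affine eta0 s Nu1; rewrite sqrrN mulNr.
have -> : u ^+ 2 / (2 * eta) = u ^+ 2 / (2 * alpha) * Num.sqrt T%:R.
  by rewrite /eta; field; rewrite !gt_eqF.
lra.
Qed.
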